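(* Let $\mu_1<\mu_2$ be real numbers, $\alpha_0,\beta_0>0$, and let $G$ be the distribution of $(x,y)$ on $\mathbb{R}\times\{-1,+1\}$ with $y$ uniform on $\{-1,+1\}$, $x\mid y=-1\sim \mathrm{N}(\mu_1,\alpha_0,\beta_0)$ and $x\mid y=+1\sim \mathrm{N}(\mu_2,\alpha_0,\beta_0)$. For $\theta\in\mathbb{R}$ let $f_\theta(x)=\mathrm{sign}(x+\theta)$ and $\mathcal{L}(f_\theta)=\Pr_{(x,y)\sim G}[f_\theta(x)\neq y]$, and let $\theta^\star=-\frac{\mu_1+\mu_2}{2}$. Then $\theta^\star$ minimizes $\mathcal{L}(f_\theta)$ over $\theta$, and there is a constant $C_1>0$ depending only on $\mu_1,\mu_2,\alpha_0,\beta_0$ such that $\mathcal{L}(f_\theta)-\mathcal{L}(f_{\theta^\star})\le C_1(\theta-\theta^\star)^2$ for all $\theta\in\mathbb{R}$. Now let $\alpha,\beta>0$ and let $G'$ be the distribution defined like $G$ but with $x\mid y=-1\sim\mathrm{N}(\mu_1,\alpha,\beta)$ and $x\mid y=+1\sim\mathrm{N}(\mu_2,\alpha,\beta)$. Fix $\theta_0\in\mathbb{R}$ and $\eta\in(0,1)$, let $(x_t,y_t)_{t\ge 0}$ be i.i.d. samples from $G'$, and define $\theta_{t+1}=\theta_t-\eta\,(\theta_t+x_t-y_t)$ (online SGD on the loss $\tfrac12(1-y(x+\theta))^2$). Then for every $t\in\mathbb{N}$, $$\mathbb{E}\big[\mathcal{L}(f_{\theta_t})\big]-\mathcal{L}(f_{\theta^\star})\le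 C_1\left((1-\eta)^{2t}(\theta_0-\theta^\star)^2+\frac{\eta}{2-\eta}\big(1-(1-\eta)^{2t}\big)\left[\frac{\alpha^2\,\Gamma(3/\beta)}{\Gamma(1/\beta)}+\Big(1-\frac{\mu_2-\mu_1}{2}\Big)^2\right]\right).$$ In particular, for fixed $t,\eta,\theta_0,\beta$ the bound is increasing in the scale $\alpha$ of the training samples.
   Context: $\mathrm{N}(\mu,\alpha,\beta)$ denotes the generalized Gaussian distribution on $\mathbb{R}$ with density $\frac{\beta}{2\alpha\Gamma(1/\beta)}e^{-(|x-\mu|/\alpha)^\beta}$ (location $\mu$, scale $\alpha>0$, shape $\beta>0$); its variance is $\alpha^2\Gamma(3/\beta)/\Gamma(1/\beta)$. $\Gamma$ is the Gamma function. The expectation is over the random samples $(x_t,y_t)$; $\theta_0$ is deterministic. *)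

(* Defs.v *)
From HB Require Import structures.
From mathcomp Require Import all_boot all_order all_algebra.
From mathcomp Require Import all_classical all_reals all_analysis.
Set Implicit Arguments. Unset Strict Implicit. Unset Printing Implicit Defensive.
Import Order.TTheory GRing.Theory Num.Theory.
Import numFieldNormedType.Exports.
Local Open Scope classical_set_scope.
Local Open Scope ring_scope.

Section defs.
Context {R : realType}.

Definition Gamma (s : R) : R :=
  Rintegral lebesgue_measure [set t : R | 0 < t]
    (fun t => t `^ (s - 1) * expR (- t)).

Definition gg_pdf (mu a b : R) (x : R) : R :=
  b / (2 * a * Gamma b^-1) * expR (- ((`|x - mu| / a) `^ b)).

(* sign classifier f_theta(x) = sign(x + theta) (sign 0 = 0) *)
Definition f_theta (theta x : R) : R := Num.sg (x + theta).

(* L(f_theta) = Pr_{(x,y)~G}[f_theta(x) <> y], for G the mixture with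
   y uniform on {-1,+1}, x | y=-1 ~ N(mu1,a,b), x | y=+1 ~ N(mu2,a,b). *)
Definition misclass (mu1 mu2 a b theta : R) : R :=
  2^-1 * Rintegral lebesgue_measure [set x | f_theta theta x != -1] (gg_pdf mu1 a b)
  + 2^-1 * Rintegral lebesgue_measure [set x | f_theta theta x != 1] (gg_pdf mu2 a b).

Definition theta_star (mu1 mu2 : R) : R := - ((mu1 + mu2) / 2).

Definition has_mixture_law d (T : measurableType d) (P : probability T R)
  (X Y : T -> R) (mu1 mu2 a b : R) : Prop :=
  [/\ measurable_fun setT X, measurable_fun setT Y,
      P [set w | Y w = -1 \/ Y w = 1] = 1%E,
      (forall A : set R, measurable A ->
         P (X @^-1` A `&` Y @^-1` [set -1]) =
           (2^-1 * Rintegral lebesgue_measure A (gg_pdf mu1 a b))%:E) &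
      (forall A : set R, measurable A ->
         P (X @^-1` A `&` Y @^-1` [set 1]) =
           (2^-1 * Rintegral lebesgue_measure A (gg_pdf mu2 a b))%:E)].

Definition mutually_independent d (T : measurableType d) (P : probability T R)
  (Z : nat -> T -> R * R) : Prop :=
  forall (s : seq nat) (B : nat -> set (R * R)), uniq s ->
    (forall i, measurable (B i)) ->
    P (\bigcap_(i in [set` s]) (Z i @^-1` B i)) =
      (\prod_(i <- s) P (Z i @^-1` B i))%E.

Fixpoint sgd (eta theta0 : R) T (X Y : nat -> T -> R) (t : nat) (w : T) : R :=
  match t with
  | O => theta0
  | t'.+1 => let th := sgd eta theta0 X Y t' w in th - eta * (th + X t' w - Y t' w)
  end.

Definition sgd_bound (C1 mu1 mu2 a b eta theta0 : R) (t : nat) : R :=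
  C1 * ((1 - eta) ^+ (2 * t) * (theta0 - theta_star mu1 mu2) ^+ 2
        + eta / (2 - eta) * (1 - (1 - eta) ^+ (2 * t))
          * (a ^+ 2 * Gamma (3 / b) / Gamma b^-1 + (1 - (mu2 - mu1) / 2) ^+ 2)).

End defs.

(* Main.v *)
Require Import Defs.
From HB Require Import structures.
From mathcomp Require Import all_boot all_order all_algebra.
From mathcomp Require Import all_classical all_reals all_analysis.
From mathcomp Require Import measurable_realfun ring lra.
Import Order.TTheory GRing.Theory Num.Theory.
Import numFieldNormedType.Exports.
Local Open Scope classical_set_scope.
Local Open Scope ring_scope.

(* For the first part, let m be the midpoint of mu1 and mu2.  Moving the decision
   threshold from m to c changes the risk by half the integral of p2 - p1 between
   m and c; this difference has the sign of x - m and is at most K |x - m|,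
   since the densities are bounded, and Lipschitz away from their (possibly
   cuspidal) centres.

   For SGD, put A t = theta_t - theta_star and W t = theta_star + x_t - y_t, so
   that A (t+1) = (1 - eta) A t - eta W t.  The W t are centered, pairwise
   uncorrelated and of second moment s2 = var + (1 - (mu2 - mu1) / 2)^2, hence
   E[A (t+1) ^ 2] = (1 - eta)^2 E[A t ^ 2] + eta^2 s2.  The substitution
   t = (x / a)^b identifies var with a^2 Gamma(3/b) / Gamma(1/b).  That the
   density integrates to one need not be computed: it is forced by the
   existence of a probability space carrying the mixture law. *)

Set Implicit Arguments.
Unset Strict Implicit.
Unset Printing Implicit Defensive.

(** * The unnormalised density: decay and integrability *)

Section expow.
Context {R : realType}.
Local Notation mu := (@lebesgue_measure R).
Implicit Types a b u v x y : R.

(** The density of N(0, a, b) without its normalising constant, so that [Gamma] stays out of all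
    estimates on the profile. *)
Definition expow a b u : R := expR (- ((`|u| / a) `^ b)).

Lemma expow_ge0 a b u : 0 <= expow a b u. Proof. exact: expR_ge0. Qed.

Lemma expow_le1 a b u : expow a b u <= 1.
Proof. by rewrite expR_le1 oppr_le0 powR_ge0. Qed.

Lemma expowN a b u : expow a b (- u) = expow a b u.
Proof. by rewrite /expow normrN. Qed.

Lemma measurable_expow a b : measurable_fun setT (expow a b).
Proof.
apply: measurableT_comp => //; apply: measurableT_comp => //.
apply: (measurableT_comp (measurable_powR _)).
by apply: measurable_funM => //; exact: measurableT_comp.
Qed.

Lemma expow_le a b u v : 0 < a -> 0 <= b -> `|u| <= `|v| ->
  expow a b v <= expow a b u.
Proof.
move=> a0 b0 uv; rewrite ler_expR lerN2; apply: ge0_ler_powR => //.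
- by rewrite nnegrE divr_ge0// ltW.
- by rewrite nnegrE divr_ge0// ltW.
- by rewrite ler_pM2r// invr_gt0.
Qed.

(** One term of the exponential series at v^b suffices: v^(b (n + 1)) / (n + 1)! dominates v^4 / (n
    + 1)! when v > 1 and b (n + 1) >= 4, whence the choice of [n]. For v <= 1 compare both sides
    with 1. *)
Lemma pow4_le_expR_powR b : 0 < b ->
  exists2 K, 0 < K & forall v, 0 <= v -> v ^+ 4 <= K * expR (v `^ b).
Proof.
move=> b0; pose n := Num.truncn (4 / b).
have f1 : 1 <= n.+1`!%:R :> R by rewrite ler1n fact_gt0.
exists (n.+1)`!%:R => [|v v0]; first by rewrite ltr0n fact_gt0.
have [v1|v1] := leP v 1.
  rewrite (@le_trans _ _ 1)// ?exprn_ile1//.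
  rewrite (@le_trans _ _ (expR (v `^ b)))//; last by rewrite ler_peMl ?expR_ge0.
  by rewrite -expR0 ler_expR powR_ge0.
have : 1 + (v `^ b) ^+ n.+1 / n.+1`!%:R <= expR (v `^ b).
  by apply: expR_ge1Dxn; exact: powR_ge0.
rewrite -(ler_pM2l (_ : 0 < (n.+1)`!%:R)); last by rewrite ltr0n fact_gt0.
apply: le_trans; rewrite mulrDr mulr1 mulrCA divff ?mulr1; last first.
  by rewrite pnatr_eq0 -lt0n fact_gt0.
rewrite (@le_trans _ _ ((v `^ b) ^+ n.+1))//; last by rewrite lerDr ler0n.
rewrite -powR_mulrn// -[leRHS]powR_mulrn ?powR_ge0// -powRrM.
apply: ler_powR; first exact: ltW.
by rewrite mulrC -ler_pdivrMr// ltW// truncnS_gt.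
Qed.

(** Supplies the integrable majorant for mass and second moment. Since [oneDsqr u] is 1 + u^2, the
    claim reduces to (1 + u^2)^2 <= 2 + 2 u^4 and the fourth-power bound at v = |u| / a. *)
Lemma expow_decay a b : 0 < a -> 0 < b ->
  exists2 K, 0 < K & forall u, (1 + u ^+ 2) * expow a b u <= K / oneDsqr u.
Proof.
move=> a0 b0; have [K K0 HK] := @pow4_le_expR_powR b b0.
exists (2 + 2 * a ^+ 4 * K) => [|u].
  by rewrite addr_gt0// mulr_gt0// mulr_gt0// exprn_gt0.
have o0 : 0 < oneDsqr u by rewrite (lt_le_trans ltr01)// oneDsqr_ge1.
rewrite ler_pdivlMr// /oneDsqr /expow expRN mulrAC ler_pdivrMr ?expR_gt0//.
pose v := `|u| / a.
have v0 : 0 <= v by rewrite divr_ge0// ltW.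
have /HK h := v0; rewrite -/v.
have e1 : 1 <= expR (v `^ b) by rewrite -expR0 ler_expR powR_ge0.
have uE : u ^+ 4 = a ^+ 4 * v ^+ 4.
  rewrite -exprMn /v mulrCA divff ?mulr1; last by rewrite gt_eqF.
  by rewrite -normrX ger0_norm// exprn_even_ge0.
have a40 : 0 <= a ^+ 4 by rewrite exprn_ge0// ltW.
have : u ^+ 4 <= a ^+ 4 * (K * expR (v `^ b)) by rewrite uE ler_wpM2l.
have : (1 + u ^+ 2) * (1 + u ^+ 2) <= 2 + 2 * u ^+ 4.
  rewrite -subr_ge0 (_ : _ - _ = (u ^+ 2 - 1) ^+ 2) ?sqr_ge0//; ring.
nra.
Qed.

Lemma integrable_oneDsqrV : mu.-integrable setT (fun u => (oneDsqr u)^-1%:E).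
Proof.
have mV : measurable_fun setT (fun u : R => (oneDsqr u)^-1).
  by apply: continuous_measurable_fun; exact: continuous_oneDsqrV.
have V0 u : 0 <= (oneDsqr u)^-1 by rewrite invr_ge0 (le_trans ler01)// oneDsqr_ge1.
apply/integrableP; split; first exact/measurable_EFinP.
under eq_integral do rewrite gee0_abs ?lee_fin//.
rewrite ge0_symfun_integralT//; last 2 first.
- exact: continuous_oneDsqrV.
- by move=> u /=; rewrite /oneDsqr sqrrN.
by rewrite -set_itvcy integral0y_oneDsqr -EFinM ltry.
Qed.

Lemma integrable_sqr_expow a b : 0 < a -> 0 < b ->
  mu.-integrable setT (fun u => ((1 + u ^+ 2) * expow a b u)%:E).
Proof.
move=> a0 b0; have [K K0 HK] := @expow_decay a b a0 b0.
have := integrableZl measurableT K integrable_oneDsqrV.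
apply: le_integrable => //.
  apply/measurable_EFinP/measurable_funM; last exact: measurable_expow.
  by apply: measurable_funD => //; exact: measurable_funX.
move=> u _ /=; rewrite lee_fin ger0_norm; last first.
  by rewrite mulr_ge0 ?expow_ge0// addr_ge0// sqr_ge0.
by rewrite (le_trans (HK u))// ler_norm.
Qed.

End expow.

(** * Invariance of Lebesgue integrals under translation and reflection *)

Section shift.
Context {R : realType}.
Local Notation mu := (@lebesgue_measure R).

Let shift (c : R) : measurableTypeR R -> measurableTypeR R := +%R^~ c.

Let measurable_shift c : measurable_fun setT (shift c).
Proof. exact: measurable_funD. Qed.

Let lebesgue_measure_shift c (A : set R) : measurable A ->
  pushforward mu (shift c) A = mu A.
Proof.
(* Lebesgue measure is determined by its values on half-open intervals. *)
move=> mA; apply/esym/lebesgue_measure_unique => //=.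
move=> _ [[a b]] _ <-.
rewrite /pushforward (_ : _ @^-1` _ = `]a - c, b - c]%classic); last first.
  by apply/seteqP; split => x /=; rewrite !in_itv/= ltrBlDr lerBrDr.
rewrite !lebesgue_measure_itv/= !lte_fin ltrD2r -!EFinB opprB.
by rewrite addrA subrK.
Qed.

Lemma ge0_integral_shift (f : R -> \bar R) (c : R) :
  measurable_fun setT f -> (forall x, 0 <= f x)%E ->
  (\int[mu]_x f (x + c)%R = \int[mu]_x f x)%E.
Proof.
move=> mf f0.
rewrite -[LHS](@ge0_integral_pushforward _ _ _ _ _ _ (measurable_shift c) lebesgue_measure setT f)//.
by apply: eq_measure_integral => //= A mA _; exact: lebesgue_measure_shift.
Qed.

Lemma ge0_integral_oppr (f : R -> \bar R) :
  measurable_fun setT f -> (forall x, 0 <= f x)%E ->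
  (\int[mu]_x f (- x)%R = \int[mu]_x f x)%E.
Proof.
move=> mf f0.
have mN : measurable_fun setT (-%R : measurableTypeR R -> measurableTypeR R) by [].
rewrite -[LHS](@ge0_integral_pushforward _ _ _ _ _ _ mN lebesgue_measure setT f)//.
by apply: eq_measure_integral => //= A mA _; exact: lebesgue_measureN.
Qed.
End shift.

(** * The substitution t = (x / a)^b in Gamma(3 / b) *)

Section gamma_substitution.
Context {R : realType}.
Local Notation mu := (@lebesgue_measure R).
Implicit Types x l r : R.
Variables a b : R.
Hypotheses (a0 : 0 < a) (b0 : 0 < b).

Let F (x : R) : R := (x / a) `^ b.
Let dF (x : R) : R := b / a * (x / a) `^ (b - 1).
Let G (t : R) : R := t `^ (3 / b - 1) * expR (- t).

Let xa_gt0 x : 0 < x -> 0 < x / a.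
Proof. by move=> x0; rewrite divr_gt0. Qed.

Lemma powR_continuous (p x : R) : 0 < x -> {for x, continuous (@powR R ^~ p)}.
Proof.
move=> x0; apply: differentiable_continuous; apply/derivable1_diffP.
by have [] := is_derive1_powR p x0.
Qed.

Let is_derive_F x : 0 < x -> is_derive x 1 F (dF x).
Proof.
move=> x0; have := is_derive1_powR b (xa_gt0 x0) => h.
have h2 : is_derive x 1 (fun y : R => y / a) a^-1.
  by apply: is_derive_eq; rewrite scaler0 add0r /GRing.scale/= mulr1.
rewrite (_ : dF x = b * (x / a) `^ (b - 1) * a^-1); last by rewrite /dF; ring.
exact: (@is_derive1_comp _ (@powR R ^~ b) (fun y : R => y / a) x _ _ h h2).
Qed.

Let cvg_dF x : 0 < x -> F^`()%classic y @[y --> x] --> dF x.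
Proof.
move=> x0.
have dFx : dF y @[y --> x] --> dF x.
  rewrite /dF; apply: cvgMl_tmp.
  have ya : y / a @[y --> x] --> x / a by apply: cvgMr_tmp; exact: cvg_id.
  by have := cvg_comp _ _ ya (@powR_continuous (b - 1) _ (xa_gt0 x0)).
apply: cvg_trans dFx; apply: near_eq_cvg; near=> y.
have y0 : 0 < y by near: y; exact: lt_nbhsr.
by rewrite derive1E (@derive_val _ _ _ _ _ _ _ (is_derive_F y0)).
Unshelve. all: by end_near. Qed.

Let F_cvg x : 0 < x -> F y @[y --> x] --> F x.
Proof.
move=> x0; apply: differentiable_continuous; apply/derivable1_diffP.
by have [] := is_derive_F x0.
Qed.

(** The exponents b (3 / b - 1) and b - 1 of x / a add up to 2. *)
Let GFdF x : 0 < x -> (G \o F) x * F^`()%classic x = b / a ^+ 3 * (x ^+ 2 * expow a b x).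
Proof.
move=> x0; rewrite derive1E (@derive_val _ _ _ _ _ _ _ (is_derive_F x0)).
rewrite /G /F /dF /expow/= (ger0_norm (ltW x0)).
set y := x / a; have y0 : 0 < y by exact: xa_gt0.
rewrite -powRrM (_ : b * (3 / b - 1) = 3 - b); last by field; rewrite gt_eqF.
have e : y `^ (3 - b) * y `^ (b - 1) = y ^+ 2.
  rewrite -powRD; last by rewrite (gt_eqF y0) implybT.
  by rewrite addrA subrK -powR_mulrn ?ltW//; congr (_ `^ _); lra.
set E := expR _.
transitivity (b / a * (y `^ (3 - b) * y `^ (b - 1)) * E); first by ring.
by rewrite e /y; field; rewrite gt_eqF.
Qed.

(** The endpoints stay positive: near 0, [dF] is unbounded if b < 1 and [G] if b > 3. *)
Let subst_itv l r : 0 < l -> l <= r ->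
  (\int[mu]_(t in `[F l, F r]) (G t)%:E =
   (b / a ^+ 3)%:E * \int[mu]_(x in `[l, r]) (x ^+ 2 * expow a b x)%:E)%E.
Proof.
move=> l0 lr; have r0 : 0 < r by exact: lt_le_trans lr.
have pos x : x \in `]l, r[ -> 0 < x by rewrite in_itv/= => /andP[/(lt_trans l0)].
rewrite integration_by_substitution_increasing//.
- rewrite -ge0_integralZl_EFin//=; last 3 first.
  + by move=> x _; rewrite lee_fin mulr_ge0 ?sqr_ge0 ?expow_ge0.
  + apply/measurable_EFinP/measurable_funTS/measurable_funM.
      exact: measurable_funX.
    exact: measurable_expow.
  + by rewrite divr_ge0 ?exprn_ge0 ?ltW.
  apply: eq_integral => x; rewrite inE/= in_itv/= => /andP[lx _].
  by rewrite -EFinM; congr EFin; apply: GFdF; exact: lt_le_trans lx.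
- move=> x y; rewrite !in_itv/= => /andP[lx _] /andP[ly _] xy.
  by apply: gt0_ltr_powR => //; rewrite ?nnegrE ?ltr_pM2r ?invr_gt0//
    divr_ge0 ?ltW// (lt_le_trans l0).
- move=> x /pos x0; rewrite /continuous_at.
  rewrite [X in _ --> X](_ : _ = dF x); first exact: cvg_dF.
  by rewrite derive1E (@derive_val _ _ _ _ _ _ _ (is_derive_F x0)).
- by apply/cvg_ex; exists (dF l); apply: cvg_at_right_filter; exact: cvg_dF.
- by apply/cvg_ex; exists (dF r); apply: cvg_at_left_filter; exact: cvg_dF.
- split.
  + by move=> x /pos x0; have [] := is_derive_F x0.
  + by apply: cvg_at_right_filter; exact: F_cvg.
  + by apply: cvg_at_left_filter; exact: F_cvg.
- apply: continuous_in_subspaceT => t; rewrite inE/= in_itv/= => /andP[Ft _].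
  have t0 : 0 < t by rewrite (lt_le_trans _ Ft)// powR_gt0// xa_gt0.
  apply: (@cvgM _ _ _ _ (@powR R ^~ (3 / b - 1)) (fun y => expR (- y))).
    exact: powR_continuous.
  have Nt : - y @[y --> t] --> - t by apply: cvgN; exact: cvg_id.
  exact: (cvg_comp _ _ Nt (@continuous_expR R _)).
Qed.

(** Monotone convergence along the intervals [1 / (n + 1), n + 1] and along their images under [F];
    both families exhaust the positive half-line, and limits are unique. *)
Lemma integral_sqr_expow_Gamma :
  (\int[mu]_(t in [set t : R | (0 < t)%R]) (t `^ (3 / b - 1) * expR (- t))%:E =
   (b / a ^+ 3)%:E * \int[mu]_(x in [set x : R | (0 < x)%R]) (x ^+ 2 * expow a b x)%:E)%E.
Proof.
pose l (n : nat) : R := n.+1%:R^-1; pose r (n : nat) : R := n.+1%:R.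
have l0 n : 0 < l n by rewrite invr_gt0.
have lr n : l n <= r n.
  by rewrite (@le_trans _ _ 1)// ?ler1n// invf_le1 ?ler1n ?ltr0n.
have l_ni m n : (m <= n)%N -> l n <= l m.
  by move=> mn; rewrite lef_pV2 ?posrE ?ltr0n// ler_nat.
have r_nd m n : (m <= n)%N -> r m <= r n by move=> mn; rewrite ler_nat.
have F_nd x y : 0 < x -> x <= y -> F x <= F y.
  move=> x0 xy; apply: (ge0_ler_powR (ltW b0)); rewrite ?nnegrE ?ler_pM2r ?invr_gt0//.
    by rewrite divr_ge0// ltW.
  by rewrite divr_ge0 ?(le_trans _ xy)// ltW.
have E1 : \bigcup_n `[l n, r n]%classic = [set x : R | 0 < x].
  apply/seteqP; split; [move=> y [n _] /=|move=> y /= y0].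
    by rewrite in_itv/= => /andP[/(lt_le_trans (l0 n))].
  exists (maxn (Num.truncn y) (Num.truncn y^-1)) => //=; rewrite in_itv/=.
  apply/andP; split.
    rewrite invf_ple ?posrE ?ltr0n// (le_trans (ltW (truncnS_gt _)))//.
    by rewrite ler_nat ltnS leq_maxr.
  by rewrite (le_trans (ltW (truncnS_gt _)))// ler_nat ltnS leq_maxl.
have E2 : \bigcup_n `[F (l n), F (r n)]%classic = [set x : R | 0 < x].
  apply/seteqP; split; [move=> t [n _] /=|move=> t /= t0].
    rewrite in_itv/= => /andP[+ _]; apply: lt_le_trans.
    by rewrite powR_gt0// xa_gt0.
  (* The point a t^(1/b) is the preimage of t under [F]. *)
  have x0 : 0 < a * t `^ b^-1 by rewrite mulr_gt0// powR_gt0.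
  have : [set x : R | 0 < x] (a * t `^ b^-1) by [].
  rewrite -E1 => -[n _]/=; rewrite in_itv/= => /andP[lx xr].
  exists n => //=; rewrite in_itv/=.
  have <- : F (a * t `^ b^-1) = t.
    rewrite /F mulrAC divff ?gt_eqF// mul1r -powRrM mulVf ?gt_eqF//.
    by rewrite powRr1// ltW.
  by rewrite !F_nd.
have mG : measurable_fun setT G.
  apply: measurable_funM; first exact: measurable_powR.
  by apply: measurableT_comp => //; exact: measurableT_comp.
have mH : measurable_fun setT (fun x => x ^+ 2 * expow a b x).
  by apply: measurable_funM; [exact: measurable_funX|exact: measurable_expow].
have c1 : (\int[mu]_(t in `[F (l n), F (r n)]) (G t)%:E @[n --> \oo] -->
    \int[mu]_(t in [set t : R | (0 < t)%R]) (G t)%:E)%E.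
  rewrite -E2; apply: ge0_nondecreasing_set_cvg_integral => //.
  - move=> m n mn; apply/subsetPset => t /=; rewrite !in_itv/= => /andP[h1 h2].
    rewrite (le_trans _ h1) ?F_nd ?l_ni//= (le_trans h2)// F_nd ?r_nd//.
  - by move=> n; exact/measurable_EFinP/measurable_funTS.
  - by move=> n x _; rewrite lee_fin mulr_ge0 ?powR_ge0 ?expR_ge0.
have c2 : ((b / a ^+ 3)%:E * \int[mu]_(x in `[l n, r n]) (x ^+ 2 * expow a b x)%:E
    @[n --> \oo] --> (b / a ^+ 3)%:E *
    \int[mu]_(x in [set x : R | (0 < x)%R]) (x ^+ 2 * expow a b x)%:E)%E.
  apply: cvgeZl => //; rewrite -E1; apply: ge0_nondecreasing_set_cvg_integral => //.
  - move=> m n mn; apply/subsetPset => t /=; rewrite !in_itv/= => /andP[h1 h2].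
    by rewrite (le_trans _ h1) ?l_ni//= (le_trans h2)// r_nd.
  - by move=> n; exact/measurable_EFinP/measurable_funTS.
  - by move=> n x _; rewrite lee_fin mulr_ge0 ?sqr_ge0 ?expow_ge0.
apply: (cvg_unique _ c1) => //; apply: cvg_trans c2.
by apply: near_eq_cvg; apply: nearW => n; rewrite subst_itv.
Qed.

End gamma_substitution.

(** * Mass and second moment of the generalized Gaussian density *)

Section gg_moments.
Context {R : realType}.
Local Notation mu := (@lebesgue_measure R).
Implicit Types a b m s x : R.

Lemma Gamma_ge0 s : 0 <= Gamma s.
Proof. by apply: Rintegral_ge0 => x _; rewrite mulr_ge0 ?powR_ge0 ?expR_ge0. Qed.

Definition gg_norm a b : R := b / (2 * a * Gamma b^-1).

Lemma gg_norm_ge0 a b : 0 < a -> 0 < b -> 0 <= gg_norm a b.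
Proof. by move=> a0 b0; rewrite divr_ge0 ?mulr_ge0 ?Gamma_ge0// ltW. Qed.

Lemma gg_pdfE m a b x : gg_pdf m a b x = gg_norm a b * expow a b (x - m).
Proof. by []. Qed.

Lemma gg_pdf_ge0 m a b x : 0 < a -> 0 < b -> 0 <= gg_pdf m a b x.
Proof. by move=> a0 b0; rewrite gg_pdfE mulr_ge0 ?gg_norm_ge0 ?expow_ge0. Qed.

Lemma measurable_gg_pdf m a b : measurable_fun setT (gg_pdf m a b).
Proof.
apply: measurable_funM => //.
apply: (measurableT_comp (measurable_expow a b)).
exact: measurable_funB.
Qed.

Lemma integrable_expow a b : 0 < a -> 0 < b ->
  mu.-integrable setT (EFin \o expow a b).
Proof.
move=> a0 b0; apply: le_integrable (integrable_sqr_expow a0 b0) => //.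
  by apply/measurable_EFinP; exact: measurable_expow.
move=> x _ /=; have p0 : 0 <= 1 + x ^+ 2 by rewrite addr_ge0// sqr_ge0.
rewrite lee_fin !ger0_norm ?mulr_ge0 ?expow_ge0//.
by rewrite ler_peMl ?expow_ge0// lerDl sqr_ge0.
Qed.

Lemma integrable_sqrM_expow a b : 0 < a -> 0 < b ->
  mu.-integrable setT (fun x => (x ^+ 2 * expow a b x)%:E).
Proof.
move=> a0 b0; apply: le_integrable (integrable_sqr_expow a0 b0) => //.
  apply/measurable_EFinP/measurable_funM; last exact: measurable_expow.
  exact: measurable_funX.
move=> x _ /=; have p0 : 0 <= 1 + x ^+ 2 by rewrite addr_ge0// sqr_ge0.
have e0 := expow_ge0 a b x; have q0 := mulr_ge0 (sqr_ge0 x) e0.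
by rewrite lee_fin !ger0_norm ?(mulr_ge0 p0 e0)// ler_wpM2r// lerDr.
Qed.

(** Translation removes the location, so the mass is the same for every [m]; this later forces both
    mixture components to have mass one. *)
Lemma integral_gg_pdf m a b : 0 < a -> 0 < b ->
  (\int[mu]_x (gg_pdf m a b x)%:E =
   (gg_norm a b)%:E * \int[mu]_x (expow a b x)%:E)%E.
Proof.
move=> a0 b0; have mE := measurable_expow a b.
rewrite -(@ge0_integral_shift _ _ m)/=.
- under eq_integral do rewrite gg_pdfE addrK EFinM.
  rewrite ge0_integralZl_EFin//; last 2 first.
  + exact/measurable_EFinP.
  + exact: gg_norm_ge0.
  by move=> x _; rewrite lee_fin expow_ge0.
- by apply/measurable_EFinP; exact: measurable_gg_pdf.
- by move=> x; rewrite lee_fin gg_pdf_ge0.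
Qed.

Lemma integrable_gg_pdf m a b : 0 < a -> 0 < b ->
  mu.-integrable setT (EFin \o gg_pdf m a b).
Proof.
move=> a0 b0; apply/integrableP; split.
  by apply/measurable_EFinP; exact: measurable_gg_pdf.
under eq_integral do rewrite gee0_abs ?lee_fin ?gg_pdf_ge0//.
rewrite integral_gg_pdf//.
have /integrable_fin_num/fineK <- := integrable_expow a0 b0; last by [].
by rewrite -EFinM ltry.
Qed.

(** The integrand is even, and its half-line integral is known from the Gamma substitution. *)
Lemma integral_sqrM_expow a b : 0 < a -> 0 < b ->
  (\int[mu]_x (x ^+ 2 * expow a b x)%:E = (2 * a ^+ 3 / b * Gamma (3 / b))%:E)%E.
Proof.
move=> a0 b0; pose h x := (x ^+ 2 * expow a b x)%:E.
have h0 x : (0 <= h x)%E by rewrite lee_fin mulr_ge0 ?sqr_ge0 ?expow_ge0.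
have ih : mu.-integrable setT h := integrable_sqrM_expow a0 b0.
have mh : measurable_fun setT h := measurable_int _ ih.
have -> : (\int[mu]_x h x = 2%:E * \int[mu]_(x in [set x | (0 < x)%R]) h x)%E.
  rewrite -(setUv [set x : R | 0 < x]) ge0_integral_setU//=; last 4 first.
  - by rewrite -set_itvoy.
  - by apply: measurableC; rewrite -set_itvoy.
  - by rewrite setUv.
  - exact/disj_setPCl.
  rewrite mule_natl mule2n; congr +%E.
  rewrite -set_itvoy setCitvr.
  transitivity (\int[mu]_(r in `]-oo, 0%R]) h (- r)%R)%E.
    by apply: eq_integral => x _; rewrite /h sqrrN expowN.
  rewrite -ge0_integration_by_substitution0//.
  by rewrite integral_itv_obnd_cbnd//; exact: measurable_funTS.
(* [Gamma] is the finite part of an extended integral; finiteness allows the substitution identity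
   to be solved in the reals. *)
have jfin : (\int[mu]_(x in [set x | (0 < x)%R]) h x)%E \is a fin_num.
  apply: integrable_fin_num; first by rewrite -set_itvoy.
  by apply: integrableS ih => //; rewrite -set_itvoy.
rewrite /Gamma /Rintegral (integral_sqr_expow_Gamma a0 b0) -/h -(fineK jfin).
rewrite -!EFinM/=.
by congr EFin; field; rewrite !gt_eqF.
Qed.

(** Reflection preserves the integral of [g], so only g(x) + g(-x) matters and an odd cross term is
    never integrated. Doubling both sides avoids dividing extended reals. *)
Lemma ge0_integral_symmetrize (g h1 h2 : R -> \bar R) :
  measurable_fun setT g -> measurable_fun setT h1 -> measurable_fun setT h2 ->
  (forall x, 0 <= g x)%E -> (forall x, 0 <= h1 x)%E -> (forall x, 0 <= h2 x)%E ->
  (forall x, g x + g (- x)%R = h1 x + h2 x + (h1 x + h2 x))%E ->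
  (\int[mu]_x g x + \int[mu]_x g x =
    (\int[mu]_x h1 x + \int[mu]_x h2 x) + (\int[mu]_x h1 x + \int[mu]_x h2 x))%E.
Proof.
move=> mg mh1 mh2 g0 h10 h20 ghE.
have mgN : measurable_fun setT (fun x => g (- x)) by exact: (measurableT_comp mg).
have mh : measurable_fun setT (fun x => h1 x + h2 x)%E by exact: emeasurable_funD.
have h0 x : (0 <= h1 x + h2 x)%E by rewrite adde_ge0.
have <- : (\int[mu]_x (h1 x + h2 x) = \int[mu]_x h1 x + \int[mu]_x h2 x)%E.
  by rewrite ge0_integralD.
transitivity (\int[mu]_x (h1 x + h2 x + (h1 x + h2 x)))%E; last first.
  by rewrite ge0_integralD.
transitivity (\int[mu]_x (g x + g (- x)%R))%E.
  by rewrite ge0_integralD// [X in (_ = _ + X)%E]ge0_integral_oppr.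
by apply: eq_integral => x _; rewrite ghE.
Qed.

(** Translating by [m] turns x - s into x + (m - s). The square of x yields the variance, the
    constant (m - s)^2 survives by unit mass, and the cross term is odd. *)
Lemma integral_sqr_gg_pdf m s a b : 0 < a -> 0 < b ->
  (\int[mu]_x (gg_pdf m a b x)%:E = 1)%E ->
  (\int[mu]_x ((x - s) ^+ 2 * gg_pdf m a b x)%:E =
   (a ^+ 2 * Gamma (3 / b) / Gamma b^-1 + (m - s) ^+ 2)%:E)%E.
Proof.
move=> a0 b0 p1; pose k := gg_norm a b.
have k0 : 0 <= k by exact: gg_norm_ge0.
have mE := measurable_expow a b.
pose g x := ((x + (m - s)) ^+ 2 * (k * expow a b x))%:E.
have kE0 x : 0 <= k * expow a b x by rewrite mulr_ge0 ?expow_ge0.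
have x2E0 x : 0 <= k * (x ^+ 2 * expow a b x).
  by rewrite mulr_ge0// mulr_ge0 ?sqr_ge0 ?expow_ge0.
have d2E0 x : 0 <= (m - s) ^+ 2 * (k * expow a b x) by rewrite mulr_ge0 ?sqr_ge0.
have g0 x : (0 <= g x)%E by rewrite lee_fin mulr_ge0 ?sqr_ge0.
have mg : measurable_fun setT g.
  apply/measurable_EFinP/measurable_funM; last exact: measurable_funM.
  by apply: measurable_funX; exact: measurable_funD.
have -> : (\int[mu]_x ((x - s) ^+ 2 * gg_pdf m a b x)%:E = \int[mu]_x g x)%E.
  rewrite -(@ge0_integral_shift _ _ m)/=.
  - by apply: eq_integral => x _; rewrite /g gg_pdfE addrK addrA.
  - apply/measurable_EFinP/measurable_funM; last exact: measurable_gg_pdf.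
    by apply: measurable_funX; exact: measurable_funB.
  - by move=> x; rewrite lee_fin mulr_ge0 ?sqr_ge0 ?gg_pdf_ge0.
have mx2 : measurable_fun setT (fun x => (x ^+ 2 * expow a b x)%:E).
  by apply/measurable_EFinP; apply: measurable_funM => //; exact: measurable_funX.
have mEE : measurable_fun setT (fun x => (expow a b x)%:E).
  exact/measurable_EFinP.
pose h1 x := (k * (x ^+ 2 * expow a b x))%:E.
pose h2 x := ((m - s) ^+ 2 * (k * expow a b x))%:E.
have h10 x : (0 <= h1 x)%E by rewrite lee_fin.
have h20 x : (0 <= h2 x)%E by rewrite lee_fin.
have mh1 : measurable_fun setT h1 
  by apply/measurable_EFinP; apply: measurable_funM => //; exact/measurable_EFinP.
have mh2 : measurable_fun setT h2.
  by apply/measurable_EFinP; do 2 apply: measurable_funM => //.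
have I1 : (\int[mu]_x h1 x = (k * (2 * a ^+ 3 / b * Gamma (3 / b)))%:E)%E.
  rewrite [RHS]EFinM -integral_sqrM_expow// -ge0_integralZl_EFin//.
  by move=> x _; rewrite lee_fin mulr_ge0 ?sqr_ge0 ?expow_ge0.
have I2 : (\int[mu]_x h2 x = ((m - s) ^+ 2)%:E)%E.
  rewrite -[RHS]mule1 -p1 integral_gg_pdf//.
  rewrite -ge0_integralZl_EFin//; last by move=> x _; rewrite lee_fin expow_ge0.
  rewrite -ge0_integralZl_EFin ?sqr_ge0//.
  - by move=> x _; rewrite -EFinM lee_fin.
  - by apply/measurable_EFinP; apply: measurable_funM.
(* Averaging [g x] and [g (- x)] kills the odd cross term. *)
have gg : (\int[mu]_x g x + \int[mu]_x g x =
    (\int[mu]_x h1 x + \int[mu]_x h2 x) + (\int[mu]_x h1 x + \int[mu]_x h2 x))%E.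
  apply: ge0_integral_symmetrize => // x.
  rewrite /g /h1 /h2 expowN -!EFinD.
  by congr EFin; ring.
move: gg; rewrite I1 I2 -!EFinD => gg.
have gfin : (\int[mu]_x g x)%E \is a fin_num.
  rewrite ge0_fin_numE ?integral_ge0//.
  rewrite (@le_lt_trans _ _ (\int[mu]_x g x + \int[mu]_x g x)%E)//.
    by rewrite leeDl// integral_ge0.
  by rewrite gg ltry.
move: gg; rewrite -(fineK gfin) -EFinD => -[] gg; congr EFin.
have kE : k = b / (2 * a) * (Gamma b^-1)^-1 by rewrite /k /gg_norm invfM mulrA.
have : k * (2 * a ^+ 3 / b * Gamma (3 / b)) = a ^+ 2 * Gamma (3 / b) / Gamma b^-1.
  (* The inverse of the Gamma value is set aside as [i], so that [field] asks only for [a] and [b]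
     to be nonzero. *)
  by rewrite kE; set i := (Gamma b^-1)^-1; field; rewrite !gt_eqF.
by move: gg; set u := fine _ => gg <-; lra.
Qed.

End gg_moments.

(** * Lipschitz bounds away from the cusp *)

Section lipschitz.
Context {R : realType}.
Implicit Types a b h u v x : R.

(** Write u^b = v^b exp(b (ln u - ln v)), then use 1 + y <= exp y and ln(v / u) <= (v - u) / u. This
    treats b < 1 and b >= 1 alike. *)
Lemma powR_sub_le b u v : 0 <= b -> 0 < u -> u <= v ->
  v `^ b - u `^ b <= v `^ b * (b * (v - u) / u).
Proof.
move=> b0 u0 uv; have v0 : 0 < v by exact: lt_le_trans uv.
have -> : u `^ b = v `^ b * expR (b * (ln u - ln v)).
  rewrite /powR !gt_eqF// -expRD; congr expR; ring.
rewrite -[X in X - _]mulr1 -mulrBr ler_wpM2l ?powR_ge0//.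
have le1 := expR_ge1Dx (b * (ln u - ln v)).
have le2 : ln v - ln u <= (v - u) / u.
  rewrite -ln_div ?posrE// (_ : v / u = 1 + (v - u) / u); last first.
    by field; rewrite gt_eqF.
  by apply: le_ln1Dx; rewrite (lt_le_trans (ltrN10 _))// divr_ge0 ?subr_ge0// ltW.
have := ler_wpM2l b0 le2; lra.
Qed.

Lemma expRN_sub_le u v : 0 <= u -> expR (- u) - expR (- v) <= `|v - u|.
Proof.
move=> u0; have [vu|uv] := leP v u.
  by rewrite (@le_trans _ _ 0)// subr_le0 ler_expR lerN2.
have -> : expR (- v) = expR (- u) * expR (- (v - u)).
  by rewrite -expRD; congr expR; ring.
rewrite -[X in X - _]mulr1 -mulrBr (@le_trans _ _ (1 - expR (- (v - u))))//.
  rewrite ler_piMl//; last by rewrite expR_le1 oppr_le0.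
  by rewrite subr_ge0 expR_le1 oppr_le0 subr_ge0 ltW.
have := expR_ge1Dx (- (v - u)); rewrite gtr0_norm ?subr_gt0//; lra.
Qed.

(** The window [h / 2, 3 h / 2] avoids the possible cusp at 0: powers are bounded by their value at
    3 h / 2, and 1 / u by 2 / h. *)
Lemma expow_sub_le a b h u v : 0 < a -> 0 <= b -> 0 < h ->
  h / 2 <= u -> u <= v -> v <= 3 * h / 2 ->
  expow a b u - expow a b v <=
  (3 * h / 2 / a) `^ b * (b * (2 / h)) * (v - u).
Proof.
move=> a0 b0 h0 hu uv vh.
have h20 : 0 < h / 2 by rewrite divr_gt0.
have u0 : 0 < u by exact: lt_le_trans hu.
have v0 : 0 < v by exact: lt_le_trans uv.
have ua0 : 0 < u / a by rewrite divr_gt0.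
have uva : u / a <= v / a by rewrite ler_pM2r ?invr_gt0.
rewrite /expow !gtr0_norm//.
apply: (le_trans (expRN_sub_le _ (powR_ge0 _ _))).
rewrite ger0_norm ?subr_ge0; last first.
  by apply: ge0_ler_powR => //; rewrite nnegrE divr_ge0 ?ltW.
apply: (le_trans (powR_sub_le b0 ua0 uva)).
rewrite -!mulrA; apply: ler_pM.
- exact: powR_ge0.
- by rewrite mulr_ge0// divr_ge0 ?subr_ge0// ltW.
- have va0 : 0 <= v / a by rewrite divr_ge0 ?ltW.
  have vha : v / a <= 3 * h / 2 / a by rewrite ler_pM2r ?invr_gt0.
  by rewrite ?mulrA; apply: ge0_ler_powR; rewrite ?nnegrE// (le_trans va0).
rewrite ler_wpM2l//.
have -> : (v / a - u / a) / (u / a) = (v - u) / u by field; rewrite !gt_eqF.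
have le : (v - u) / u <= (v - u) * (2 / h).
  by rewrite ler_wpM2l ?subr_ge0// -invf_div lef_pV2// posrE.
by apply: (le_trans le); rewrite le_eqVlt; apply/orP/or_introl/eqP; ring.
Qed.

(** Later [h] is half the distance between the means and [x] the offset from the midpoint. If |x| >=
    h / 2, the difference is at most 1 <= (2 / h) |x|. Otherwise h - x and h + x lie in the window
    above at distance 2 |x|, which explains the term 2 C. *)
Lemma expow_shift_lipschitz a b h : 0 < a -> 0 < b -> 0 < h ->
  exists2 K, 0 < K &
    forall x, `|expow a b (x - h) - expow a b (x + h)| <= K * `|x|.
Proof.
move=> a0 b0 h0; pose C := (3 * h / 2 / a) `^ b * (b * (2 / h)).
have C0 : 0 <= C by rewrite mulr_ge0 ?powR_ge0// mulr_ge0 ?divr_ge0 ?ltW.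
exists (2 * C + 2 / h) => [|x]; first by rewrite ltr_wpDl// ?divr_gt0// mulr_ge0.
have e0 := expow_ge0 a b; have e1 := expow_le1 a b.
have [hx|xh] := leP (h / 2) `|x|.
  apply: (@le_trans _ _ (2 / h * `|x|)).
    apply: (@le_trans _ _ 1).
      have := e0 (x - h); have := e0 (x + h); have := e1 (x - h).
      by have := e1 (x + h); rewrite ler_norml; lra.
    by rewrite -invf_div ler_pdivlMl ?divr_gt0// mulr1.
  by rewrite ler_wpM2r// lerDr mulr_ge0.
apply: (@le_trans _ _ (2 * C * `|x|)); last first.
  by rewrite ler_wpM2r// lerDl divr_ge0// ltW.
(* By evenness the arguments are h - x and h + x; changing the sign of [x] swaps them. *)
have -> : expow a b (x - h) = expow a b (h - x) by rewrite -expowN opprB.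
rewrite [x + h]addrC; wlog x0 : x xh / 0 <= x => [H|].
  have [x0|x0] := leP 0 x; first exact: H.
  have := H (- x); rewrite normrN opprK distrC; apply => //.
  by rewrite oppr_ge0 ltW.
move: xh; rewrite ger0_norm// => xh.
rewrite ger0_norm; last first.
  by rewrite subr_ge0 expow_le ?(ltW b0)// !ger0_norm; lra.
apply: le_trans (expow_sub_le (h := h) a0 (ltW b0) h0 _ _ _) _; try lra.
by rewrite -/C; have := mulr_ge0 C0 x0; nra.
Qed.

End lipschitz.

(** * The risk as a function of the threshold *)

Section threshold_risk.
Context {R : realType}.
Local Notation mu := (@lebesgue_measure R).
Implicit Types (p q : R -> R) (c d : R).

(* Twice the error of the classifier that predicts +1 to the right of [c]. *)
Definition threshold_risk p q c : R :=
  Rintegral mu `[c, +oo[ p + Rintegral mu `]-oo, c] q.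

(** Moving the threshold takes the interval ]c, d] from the half-line of [p] and gives it to that of
    [q]; endpoints are negligible. *)
Lemma threshold_risk_sub p q c d : c <= d ->
  mu.-integrable setT (EFin \o p) -> mu.-integrable setT (EFin \o q) ->
  threshold_risk p q d - threshold_risk p q c =
  Rintegral mu `]c, d] (fun x => q x - p x).
Proof.
move=> cd ip iq.
have ipS A : measurable A -> mu.-integrable A (EFin \o p).
  by move=> mA; exact: integrableS ip.
have iqS A : measurable A -> mu.-integrable A (EFin \o q).
  by move=> mA; exact: integrableS iq.
have qE : Rintegral mu `]-oo, d] q - Rintegral mu `]-oo, c] q =
    Rintegral mu `]c, d] q.
  by apply: Rintegral_itvB; rewrite ?bnd_simp//; exact: iqS.
have pE : Rintegral mu `]c, +oo[ p - Rintegral mu `]c, d] p =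
    Rintegral mu `]d, +oo[ p.
  by apply: Rintegral_itvB; rewrite ?bnd_simp//; exact: ipS.
rewrite RintegralB//; [|exact: iqS|exact: ipS].
rewrite /threshold_risk.
rewrite -[in LHS](@Rintegral_itv_obnd_cbnd _ d)//; last exact: ipS.
rewrite -[in LHS](@Rintegral_itv_obnd_cbnd _ c)//; last exact: ipS.
rewrite -qE -pE; lra.
Qed.

Lemma measurable_threshold_risk p q :
  (forall x, 0 <= p x) -> (forall x, 0 <= q x) ->
  mu.-integrable setT (EFin \o p) -> mu.-integrable setT (EFin \o q) ->
  measurable_fun setT (threshold_risk p q).
Proof.
move=> p0 q0 ip iq.
have mono (f : R -> R) (A B : set R) : (forall x, 0 <= f x) ->
    mu.-integrable setT (EFin \o f) -> measurable A -> measurable B ->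
    A `<=` B -> Rintegral mu A f <= Rintegral mu B f.
  move=> f0 intf mA mB AB; rewrite /Rintegral fine_le//.
  - by apply: integrable_fin_num => //; exact: integrableS intf.
  - by apply: integrable_fin_num => //; exact: integrableS intf.
  - apply: ge0_subset_integral => //; last by move=> x _; rewrite lee_fin.
    by apply: measurable_funTS; exact: measurable_int intf.
apply: measurable_funD.
  (* The first term is nonincreasing in [c]; composed with negation it becomes nondecreasing, hence
     measurable. *)
  rewrite (_ : (fun c => _) = (fun c => Rintegral mu `[- c, +oo[ p) \o -%R).
    apply: measurableT_comp => //; apply: nondecreasing_measurable => // c d cd.
    by apply: mono => //; apply: subset_itvr; rewrite bnd_simp lerN2.
  by apply/funext => c /=; rewrite opprK.
apply: nondecreasing_measurable => // c d cd.
by apply: mono => //; apply: subset_itvl; rewrite bnd_simp.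
Qed.

(** At x = - theta the sign is 0, an error for either label, so both half-lines are closed. *)
Lemma misclassE (mu1 mu2 a b theta : R) : misclass mu1 mu2 a b theta =
  2^-1 * threshold_risk (gg_pdf mu1 a b) (gg_pdf mu2 a b) (- theta).
Proof.
rewrite /misclass.
have -> : [set x | f_theta theta x != -1] = `[- theta, +oo[%classic.
  apply/seteqP; split => x /=; rewrite in_itv/= andbT /f_theta sgr_cp0 -leNgt;
    by rewrite -lerBlDr sub0r.
have -> : [set x | f_theta theta x != 1] = `]-oo, - theta]%classic.
  apply/seteqP; split => x /=; rewrite in_itv/= /f_theta sgr_cp0 -leNgt;
    by rewrite -lerBrDr sub0r.
by rewrite -mulrDr.
Qed.

End threshold_risk.

Lemma half_le {R : realFieldType} (x y : R) : `|x| <= y -> 2^-1 * x <= y.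
Proof. by move/ler_normlP=> []; lra. Qed.

(** * Optimality of the midpoint and the quadratic excess risk *)

Section misclass.
Context {R : realType}.
Local Notation mu := (@lebesgue_measure R).
Variables mu1 mu2 a b : R.
Hypotheses (mu12 : mu1 < mu2) (a0 : 0 < a) (b0 : 0 < b).

Let m := (mu1 + mu2) / 2.
Let h := (mu2 - mu1) / 2.
Let p := gg_pdf mu1 a b.
Let q := gg_pdf mu2 a b.
Let ip : mu.-integrable setT (EFin \o p). Proof. exact: integrable_gg_pdf. Qed.
Let iq : mu.-integrable setT (EFin \o q). Proof. exact: integrable_gg_pdf. Qed.

Let misclass_sub c d : c <= d ->
  misclass mu1 mu2 a b (- d) - misclass mu1 mu2 a b (- c) =
  2^-1 * Rintegral mu `]c, d] (fun x => q x - p x).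
Proof.
by move=> cd; rewrite -threshold_risk_sub// !misclassE !opprK mulrBr.
Qed.

Lemma measurable_misclass : measurable_fun setT (misclass mu1 mu2 a b).
Proof.
rewrite (_ : misclass mu1 mu2 a b = fun t => 2^-1 * threshold_risk p q (- t)).
  apply: measurable_funM => //.
  apply: (measurableT_comp (f := threshold_risk p q)) => //.
  apply: measurable_threshold_risk => // x; exact: gg_pdf_ge0.
by apply/funext => t; exact: misclassE.
Qed.

Lemma misclass_ge0 t : 0 <= misclass mu1 mu2 a b t.
Proof.
by rewrite addr_ge0// mulr_ge0// Rintegral_ge0// => x _; exact: gg_pdf_ge0.
Qed.

(** Right of the midpoint, x is no farther from [mu2] than from [mu1], and the profile decreases
    with distance. *)
Let le_pq x : m <= x -> p x <= q x.
Proof.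
move=> mx; rewrite /p /q !gg_pdfE ler_wpM2l ?gg_norm_ge0//.
rewrite expow_le ?(ltW b0)//.
rewrite (@ger0_norm _ (x - mu1)); last by move: mx mu12; rewrite /m; lra.
by rewrite ler_norml; move: mx mu12; rewrite /m; lra.
Qed.

Let le_qp x : x <= m -> q x <= p x.
Proof.
move=> mx; rewrite /p /q !gg_pdfE ler_wpM2l ?gg_norm_ge0//.
rewrite expow_le ?(ltW b0)//.
rewrite (@ler0_norm _ (x - mu2)); last by move: mx mu12; rewrite /m; lra.
by rewrite ler_norml; move: mx mu12; rewrite /m; lra.
Qed.

Let theta_starE : theta_star mu1 mu2 = - m. Proof. by []. Qed.

Lemma theta_star_optimal theta :
  misclass mu1 mu2 a b (theta_star mu1 mu2) <= misclass mu1 mu2 a b theta.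
Proof.
rewrite theta_starE -(opprK theta); set c := - theta.
rewrite -subr_ge0; have [mc|cm] := leP m c.
  rewrite misclass_sub// mulr_ge0// Rintegral_ge0// => x /=.
  by rewrite in_itv/= => /andP[/ltW mx _]; rewrite subr_ge0 le_pq.
rewrite -oppr_le0 opprB misclass_sub ?(ltW cm)// pmulr_rle0 ?invr_gt0//.
rewrite -oppr_ge0 -mulN1r -RintegralZl//; last first.
  by apply: integrableS (integrableB _ iq ip).
apply: Rintegral_ge0 => x /=.
by rewrite in_itv/= => /andP[_ xm]; rewrite mulN1r opprB subr_ge0 le_qp.
Qed.

Lemma misclass_quadratic : exists2 C, 0 < C & forall theta,
  misclass mu1 mu2 a b theta - misclass mu1 mu2 a b (theta_star mu1 mu2) <=
  C * (theta - theta_star mu1 mu2) ^+ 2.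
Proof.
have h0 : 0 < h by rewrite /h divr_gt0// subr_gt0.
have [K K0 HK] := expow_shift_lipschitz a0 b0 h0.
pose k := gg_norm a b; have k0 : 0 <= k by exact: gg_norm_ge0.
pose L := k * K; have L0 : 0 <= L by rewrite mulr_ge0// ltW.
have qp_le x : `|q x - p x| <= L * `|x - m|.
  rewrite /L /q /p !gg_pdfE -mulrBr normrM (ger0_norm k0) -mulrA ler_wpM2l//.
  have e1 : x - mu2 = x - m - h by rewrite /m /h; lra.
  have e2 : x - mu1 = x - m + h by rewrite /m /h; lra.
  by rewrite e1 e2 HK.
(* Used with [m] as one endpoint: an integrand of size at most L (d - c) over length d - c. *)
have bound c d : c <= d -> (forall x, c <= x <= d -> `|x - m| <= d - c) ->
    `|Rintegral mu `]c, d] (fun x => q x - p x)| <= L * (d - c) ^+ 2.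
  move=> cd xm.
  have iqp : mu.-integrable `]c, d] (EFin \o (fun x => q x - p x)).
    by apply: integrableS (integrableB _ iq ip).
  have icst : mu.-integrable `]c, d] (EFin \o (fun=> L * (d - c))).
    apply/integrableP; split; first exact: measurable_cst.
    rewrite /= integral_cst//= lebesgue_measure_itv/=.
    by case: ifP => _; rewrite ?mule0 -?EFinB -?EFinM ltry.
  apply: (le_trans (le_normr_Rintegral _ iqp)) => //.
  apply: (@le_trans _ _ (Rintegral mu `]c, d] (fun=> L * (d - c)))).
    apply: le_Rintegral => //; first exact: integrable_norm.
    move=> x /=; rewrite in_itv/= => /andP[/ltW cx xd].
    by rewrite (le_trans (qp_le x))// ler_wpM2l// xm// cx.
  have len : fine (mu `]c, d]) = d - c.
    rewrite lebesgue_measure_itv/= lte_fin; case: ltP => //= dc.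
    by apply/esym/eqP; rewrite subr_eq0 eq_le cd dc.
  by rewrite Rintegral_cst// (_ : fine _ = d - c)// expr2 mulrA.
(* Adding 1 makes the constant positive: [L] is only known to be nonnegative, like [gg_norm]. *)
exists (L + 1) => [|theta]; first by rewrite ltr_wpDl.
rewrite theta_starE -(opprK theta); set c := - theta.
have Lc : L * (c - m) ^+ 2 <= (L + 1) * (c - m) ^+ 2.
  by rewrite ler_wpM2r ?sqr_ge0// lerDl.
have sq : (- c - - m) ^+ 2 = (c - m) ^+ 2 by ring.
rewrite sq; apply: le_trans Lc.
have [mc|/ltW cm] := leP m c.
  rewrite misclass_sub// half_le// bound// => x /andP[mx xc].
  by rewrite ger0_norm ?subr_ge0// lerB.
rewrite -opprB misclass_sub// -mulrN half_le// normrN.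
have -> : (c - m) ^+ 2 = (m - c) ^+ 2 by ring.
by rewrite bound// => x /andP[cx xm]; rewrite ler0_norm ?subr_le0// opprB lerB.
Qed.

End misclass.

(** * Integration against a measure given by a density *)

Section density.
Local Open Scope ereal_scope.
Context d (T : measurableType d) (R : realType).

(** [nu] is finite and dominated by [mu]. Its Radon-Nikodym derivative has the same integrals as [g]
    over all measurable sets, so the two agree almost everywhere. *)
Lemma ge0_integral_density (nu : {measure set T -> \bar R})
    (mu : {sigma_finite_measure set T -> \bar R}) (g : T -> R) :
  (forall x, (0 <= g x)%R) -> mu.-integrable setT (EFin \o g) ->
  (forall A, measurable A -> nu A = \int[mu]_(x in A) (g x)%:E) ->
  forall f : T -> \bar R, measurable_fun setT f -> (forall x, 0 <= f x) ->
  \int[nu]_x f x = \int[mu]_x (f x * (g x)%:E).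
Proof.
move=> g0 ig nuE f mf f0.
have mg : measurable_fun setT (EFin \o g) := measurable_int _ ig.
have nuT : nu setT < +oo.
  by rewrite nuE// ltey_eq (integrable_fin_num _ ig).
(* Restriction to the whole space changes no value but carries the structure of a finite measure. *)
pose nu' : {finite_measure set T -> \bar R} := mfrestr measurableT nuT.
have nu'E A : nu' A = nu A by rewrite /= /mfrestr /mrestr setIT.
have dom : nu' `<< mu.
  apply/null_content_dominatesP => A mA muA0; rewrite nu'E nuE//.
  by apply: null_set_integral => //; exact: measurable_funTS.
have -> : \int[nu]_x f x = \int[nu']_x f x 
  by apply: eq_measure_integral => A _ _; exact/esym/nu'E.
rewrite -(Radon_Nikodym_SigmaFinite.change_of_variables dom)//.
have iRN := Radon_Nikodym_SigmaFinite.f_integrable dom.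
apply: ae_eq_integral => //.
- by apply: emeasurable_funM => //; exact: measurable_int iRN.
- exact: emeasurable_funM.
apply: ae_eqe_mul2l; apply: integral_ae_eq => // A _ mA.
by rewrite -Radon_Nikodym_SigmaFinite.f_integral// nu'E nuE.
Qed.

Lemma ge0_integral_mrestr (mu : probability T R) (D : set T) (mD : measurable D)
    (f : T -> \bar R) : measurable_fun setT f -> (forall x, 0 <= f x) ->
  \int[mrestr mu mD]_x f x = \int[mu]_(x in D) f x.
Proof.
move=> mf f0.
have iD : mu.-integrable setT (EFin \o \1_D).
  apply/integrableP; split; first exact/measurable_EFinP/measurable_indic.
  under eq_integral do rewrite gee0_abs ?lee_fin//=.
  by rewrite integral_indic// setIT (le_lt_trans (probability_le1 _ mD)) ?ltry.
rewrite (@ge0_integral_density _ mu \1_D)//.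
  by rewrite [RHS]integral_mkcond; apply: eq_integral => x _; rewrite epatch_indic.
by move=> A mA; rewrite integral_indic// setIC.
Qed.

End density.

(** * The law of a variable on an event *)

Section restricted_law.
Local Open Scope ereal_scope.
Context d (T : measurableType d) (R : realType) (P : probability T R).
Local Notation mu := (@lebesgue_measure R).

(** The measure with density [g] is the pushforward by [X] of [P] restricted to [D]. *)
Lemma ge0_integral_restricted_law (X : T -> R) (D : set T) (g : R -> R) :
  measurable D -> measurable_fun setT X ->
  (forall x, (0 <= g x)%R) -> mu.-integrable setT (EFin \o g) ->
  (forall A : set R, measurable A ->
    P (X @^-1` A `&` D) = \int[mu]_(x in A) (g x)%:E) ->
  forall h : R -> \bar R, measurable_fun setT h -> (forall x, 0 <= h x) ->
  \int[P]_(w in D) h (X w) = \int[mu]_x (h x * (g x)%:E).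
Proof.
move=> mD mX g0 ig PE h mh h0.
have mX' : measurable_fun setT (X : T -> measurableTypeR R) by [].
have mhX : measurable_fun setT (h \o X) by exact: measurableT_comp.
rewrite -(@ge0_integral_mrestr _ _ _ P D mD (h \o X))//; last first.
  by move=> w; exact: h0.
rewrite -(@ge0_integral_pushforward _ _ _ _ _ _ mX' (mrestr P mD) setT h)//.
exact: ge0_integral_density.
Qed.

End restricted_law.

(** Given the label, theta_star + x - y has mean 1 - (m2 - m1) / 2 or its opposite, so the terms
    linear in [s] cancel. *)
Lemma mixture_sqr_algebra (R : realFieldType) (v m1 m2 s : R) :
  2^-1 * (v + (m1 - - (- ((m1 + m2) / 2) + 1 + s)) ^+ 2) +
  2^-1 * (v + (m2 - - (- ((m1 + m2) / 2) - 1 + s)) ^+ 2) =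
  v + (1 - (m2 - m1) / 2) ^+ 2 + s ^+ 2.
Proof. by field. Qed.

(** * Moments of the mixture *)

Section mixture_moments.
Context (R : realType) d (T : measurableType d) (P : probability T R).
Local Notation mu := (@lebesgue_measure R).
Variables (X Y : T -> R) (mu1 mu2 a b : R).
Hypotheses (a0 : 0 < a) (b0 : 0 < b) (HXY : has_mixture_law P X Y mu1 mu2 a b).

Local Notation v := (a ^+ 2 * Gamma (3 / b) / Gamma b^-1).
Let D1 := Y @^-1` [set -1].
Let D2 := Y @^-1` [set 1].

Let mX : measurable_fun setT X. Proof. by case: HXY. Qed.
Let mY : measurable_fun setT Y. Proof. by case: HXY. Qed.

Let mD1 : measurable D1. Proof. by rewrite -(setTI D1); exact: mY. Qed.
Let mD2 : measurable D2. Proof. by rewrite -(setTI D2); exact: mY. Qed.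

Let D12 : D1 `&` D2 = set0.
Proof. by apply/seteqP; split => // w []; rewrite /D1 /D2/= => -> ?; lra. Qed.

Let PD12 : P (D1 `|` D2) = 1%E. Proof. by case: HXY. Qed.

(** The two label events have total probability one, and each has half the mass of its component;
    the masses coincide by translation. *)
Lemma mixture_integral_gg_pdf m : (\int[mu]_x (gg_pdf m a b x)%:E = 1)%E.
Proof.
have fin := integrable_fin_num measurableT (integrable_gg_pdf m a0 b0).
have E m' : Rintegral mu setT (gg_pdf m' a b) = Rintegral mu setT (gg_pdf m a b).
  by rewrite /Rintegral !integral_gg_pdf.
rewrite -(fineK fin); congr EFin.
have : (P D1 + P D2 = 1)%E by rewrite -measureU.
have [_ _ _ /(_ setT measurableT) + /(_ setT measurableT)] := HXY.
rewrite !preimage_setT !setTI => PD1 PD2.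
rewrite /D1 /D2 {}PD1 {}PD2 !E -EFinD => -[].
rewrite /Rintegral /comp; lra.
Qed.

Let integral_component m (s : R) (D : set T) : measurable D ->
  (forall A : set R, measurable A ->
     P (X @^-1` A `&` D) = (2^-1 * Rintegral mu A (gg_pdf m a b))%:E) ->
  (\int[P]_(w in D) ((X w - s) ^+ 2)%:E = (2^-1 * (v + (m - s) ^+ 2))%:E)%E.
Proof.
move=> mD PE.
have ip := integrable_gg_pdf m a0 b0.
have p0 x := gg_pdf_ge0 m x a0 b0.
have ms : measurable_fun setT (fun x : R => (x - s) ^+ 2).
  by apply: measurable_funX; exact: measurable_funB.
have ms' : measurable_fun setT (fun x : R => ((x - s) ^+ 2)%:E).
  exact/measurable_EFinP.
rewrite (@ge0_integral_restricted_law _ _ _ P X D (fun x => 2^-1 * gg_pdf m a b x)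
  mD mX _ _ _ (fun x => ((x - s) ^+ 2)%:E))//.
- under eq_integral do rewrite -EFinM mulrCA EFinM.
  rewrite ge0_integralZl_EFin//.
  + by rewrite integral_sqr_gg_pdf// mixture_integral_gg_pdf.
  + by move=> x _; rewrite lee_fin mulr_ge0 ?sqr_ge0.
  + apply/measurable_EFinP; apply: measurable_funM => //.
    exact: measurable_gg_pdf.
- by move=> x; rewrite mulr_ge0.
- exact: (integrableZl _ 2^-1 ip).
- move=> A mA; rewrite PE// EFinM.
  have ipA : mu.-integrable A (EFin \o gg_pdf m a b) by exact: integrableS ip.
  under [RHS]eq_integral do rewrite EFinM.
  by rewrite integralZl// /Rintegral fineK// integrable_fin_num.
- by move=> x; rewrite lee_fin sqr_ge0.
Qed.

(** The integral splits over the two label events, whose complement is null. The shift [s] is free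
    so that s = 0 gives the second moment and s = 1 then gives the mean. *)
Lemma mixture_sqr (s : R) :
  (\int[P]_w ((theta_star mu1 mu2 + X w - Y w + s) ^+ 2)%:E =
   (v + (1 - (mu2 - mu1) / 2) ^+ 2 + s ^+ 2)%:E)%E.
Proof.
pose f w := ((theta_star mu1 mu2 + X w - Y w + s) ^+ 2)%:E.
have f0 w : (0 <= f w)%E by rewrite lee_fin sqr_ge0.
have mf : measurable_fun setT f.
  apply/measurable_EFinP; apply: measurable_funX; apply: measurable_funD => //.
  by apply: measurable_funB => //; exact: measurable_funD.
have mD : measurable (D1 `|` D2) by exact: measurableU.
have mC : measurable (~` (D1 `|` D2)) by exact: measurableC.
have PC : P (~` (D1 `|` D2)) = 0%E by rewrite probability_setC// PD12 subee.
transitivity (\int[P]_w f w)%E; first by [].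
transitivity (\int[P]_(w in D1 `|` D2) f w)%E.
  rewrite -(setUv (D1 `|` D2)) ge0_integral_setU//; last 2 first.
  - by rewrite setUv.
  - exact/disj_setPCl.
  rewrite [X in (_ + X)%E]null_set_integral ?adde0//.
  exact: measurable_funTS.
rewrite ge0_integral_setU//; last 2 first.
- exact: measurable_funTS.
- by apply/disj_setPS; rewrite D12.
have [_ _ _ P1 P2] := HXY.
have <- := mixture_sqr_algebra v mu1 mu2 s.
rewrite EFinD; congr (_ + _)%E.
- rewrite -(integral_component _ mD1 P1); apply: eq_integral => w.
  by rewrite inE /f /theta_star => ->; congr (_ ^+ 2)%:E; ring.
- rewrite -(integral_component _ mD2 P2); apply: eq_integral => w.
  by rewrite inE /f /theta_star => ->; congr (_ ^+ 2)%:E; ring.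
Qed.

End mixture_moments.

(** * Square-integrable variables on a probability space *)

Section square_integrable.
Context (R : realType) d (T : measurableType d) (P : probability T R).
Implicit Types f g : T -> R.

Definition sq_integrable f :=
  measurable_fun setT f /\ P.-integrable setT (fun w => (f w ^+ 2)%:E).

(** The majorant is |f g| <= f^2 + g^2. *)
Lemma sq_integrable_mul f g : sq_integrable f -> sq_integrable g ->
  P.-integrable setT (EFin \o (fun w => f w * g w)).
Proof.
move=> [mf if2] [mg ig2].
apply: le_integrable (integrableD measurableT if2 ig2) => //.
  by apply/measurable_EFinP; exact: measurable_funM.
move=> w _ /=; rewrite lee_fin normrM.
rewrite [leRHS]ger0_norm; last by rewrite addr_ge0// sqr_ge0.
rewrite -(real_normK (num_real (f w))) -(real_normK (num_real (g w))).
have := sqr_ge0 (`|f w| - `|g w|); have := sqr_ge0 (`|f w| + `|g w|); nra.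
Qed.

Lemma sq_integrable_cst c : sq_integrable (cst c).
Proof.
split; first exact: measurable_cst.
rewrite -[X in integrable _ _ X]/(cst (c ^+ 2)%:E).
apply/integrableP; split; first exact: measurable_cst.
by rewrite /= integral_cst//= probability_setT mule1 ltry.
Qed.

Lemma sq_integrable_integrable f : sq_integrable f ->
  P.-integrable setT (EFin \o f).
Proof.
move=> /sq_integrable_mul /(_ (sq_integrable_cst 1)).
by congr (P.-integrable _ _); apply/funext => w /=; rewrite mulr1.
Qed.

Lemma integrable_linear_comb (c e : R) f g : P.-integrable setT (EFin \o f) ->
  P.-integrable setT (EFin \o g) ->
  P.-integrable setT (EFin \o (fun w => c * f w + e * g w)).
Proof.
move=> fi gi.
exact: (integrableD measurableT (integrableZl measurableT c fi)
  (integrableZl measurableT e gi)).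
Qed.

Lemma Rintegral_linear_comb (c e : R) f g : P.-integrable setT (EFin \o f) ->
  P.-integrable setT (EFin \o g) ->
  Rintegral P setT (fun w => c * f w + e * g w) =
  c * Rintegral P setT f + e * Rintegral P setT g.
Proof.
move=> fi gi; rewrite RintegralD//; last 2 first.
- exact: (integrableZl measurableT c fi).
- exact: (integrableZl measurableT e gi).
by rewrite !RintegralZl.
Qed.

Lemma sq_integrable_linear_comb (c e : R) f g :
  sq_integrable f -> sq_integrable g ->
  sq_integrable (fun w => c * f w + e * g w).
Proof.
move=> sf sg; have [mf if2] := sf; have [mg ig2] := sg.
split; first by apply: measurable_funD; exact: measurable_funM.
have i1 := integrable_linear_comb (c ^+ 2) (2 * c * e) if2 (sq_integrable_mul sf sg).
have := integrable_linear_comb 1 (e ^+ 2) i1 ig2.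
by congr (P.-integrable _ _); apply/funext => w /=; congr EFin; ring.
Qed.

End square_integrable.

(** * Independence and vanishing correlations *)

Section independence.
Context (R : realType) d (T : measurableType d) (P : probability T R).

(** The joint law agrees with the product of the marginals on rectangles, hence everywhere. By
    Fubini the inner integral is x E[V] = 0. *)
Lemma independent_centered_mul (U V : T -> R) :
  measurable_fun setT U -> measurable_fun setT V ->
  P.-integrable setT (EFin \o V) ->
  P.-integrable setT (EFin \o (fun w => U w * V w)) ->
  (forall A B : set R, measurable A -> measurable B ->
     P (U @^-1` A `&` V @^-1` B) = (P (U @^-1` A) * P (V @^-1` B))%E) ->
  Rintegral P setT V = 0 -> Rintegral P setT (fun w => U w * V w) = 0.
Proof.
move=> mU mV iV iUV indep EV0.
pose U' : {RV P >-> R} := HB.pack U (isMeasurableFun.Build _ _ _ _ _ mU).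
pose V' : {RV P >-> R} := HB.pack V (isMeasurableFun.Build _ _ _ _ _ mV).
pose UV w := (U w, V w).
have mUV : measurable_fun setT UV by exact: measurable_fun_pair.
pose UV' : {RV P >-> (R * R)%type} := HB.pack UV (isMeasurableFun.Build _ _ _ _ _ mUV).
pose prod (z : R * R) := (z.1 * z.2)%:E.
have mprod : measurable_fun setT prod.
  by apply/measurable_EFinP; apply: measurable_funM.
have prodE A : measurable A ->
    (distribution P U' \x distribution P V')%E A = distribution P UV' A.
  by apply: product_measure_unique => B C mB mC; exact: indep.
(* Integrability of the product is transported from the law of (U, V) to the equal product
   measure. *)
have iprod : (distribution P U' \x distribution P V')%E.-integrable setT prod.
  have /integrableP[_] : (distribution P UV').-integrable setT prod.
    exact: integrable_pushforward.
  move=> h; apply/integrableP; split => //; apply: le_lt_trans h.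
  by rewrite (eq_measure_integral (distribution P UV'))// => A mA _; exact: prodE.
rewrite /Rintegral.
have -> : (\int[P]_w (U w * V w)%:E = \int[distribution P UV']_z prod z)%E.
  by rewrite integral_distribution.
rewrite -(eq_measure_integral (distribution P UV') (fun A mA _ => prodE A mA)).
rewrite -integral12_prod_meas1// (eq_integral (cst 0%E)) ?integral0//.
move=> x _; rewrite /fubini_F /prod/=.
under eq_integral do rewrite EFinM.
have iV' : (distribution P V').-integrable setT EFin.
  exact: integrable_pushforward.
rewrite integralZl// integral_distribution//.
have -> : (\int[P]_w (EFin \o V') w = (Rintegral P setT V)%:E)%E.
  by rewrite /Rintegral fineK// integrable_fin_num.
by rewrite EV0 mule0.
Qed.

Lemma mutually_independent_pair (Z : nat -> T -> R * R) (phi : R * R -> R) i j :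
  measurable_fun setT phi -> mutually_independent P Z -> i != j ->
  forall A B : set R, measurable A -> measurable B ->
  P ((phi \o Z i) @^-1` A `&` (phi \o Z j) @^-1` B) =
  (P ((phi \o Z i) @^-1` A) * P ((phi \o Z j) @^-1` B))%E.
Proof.
move=> mphi indep ij A B mA mB.
pose C k := if k == i then phi @^-1` A else phi @^-1` B.
have mC k : measurable (C k).
  by rewrite /C; case: ifP => _; rewrite -[X in measurable X]setTI; exact: mphi.
have Ci : C i = phi @^-1` A by rewrite /C eqxx.
have Cj : C j = phi @^-1` B by rewrite /C eq_sym (negbTE ij).
have := indep [:: i; j] C; rewrite /= inE ij => /(_ isT mC).
rewrite big_cons big_seq1 Ci Cj => <-; congr (P _).
apply/seteqP; split => w /=.
  by move=> [hA hB] k /=; rewrite !inE => /orP[/eqP->|/eqP->]; rewrite ?Ci ?Cj.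
move=> H; split.
  by have := H i; rewrite /= !inE eqxx Ci; exact.
by have := H j; rewrite /= !inE eqxx orbT Cj; exact.
Qed.

End independence.

(** * Second moment of a linear recursion with uncorrelated noise *)

Section recursion.
Context (R : realType) d (T : measurableType d) (P : probability T R).
Variables (W A : nat -> T -> R) (eta c s2 : R).
Hypotheses (eta01 : 0 < eta < 1)
  (sW : forall t, sq_integrable P (W t))
  (EW : forall t, Rintegral P setT (W t) = 0)
  (EW2 : forall t, Rintegral P setT (fun w => W t w ^+ 2) = s2)
  (EWW : forall t u, t != u -> Rintegral P setT (fun w => W t w * W u w) = 0)
  (A0 : A 0 = cst c)
  (AS : forall t, A t.+1 = fun w => (1 - eta) * A t w + (- eta) * W t w).

Lemma sq_integrable_recursion t : sq_integrable P (A t).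
Proof.
elim: t => [|t IH]; first by rewrite A0; exact: sq_integrable_cst.
by rewrite AS; exact: sq_integrable_linear_comb.
Qed.

(** [A t] combines a constant with the noises before time [t], each uncorrelated with [W u]. All u
    >= t are treated together, as the induction passes from u >= t + 1 back to u >= t. *)
Lemma recursion_uncorrelated t u : (t <= u)%N ->
  Rintegral P setT (fun w => A t w * W u w) = 0.
Proof.
elim: t u => [|t IH] u tu.
  rewrite A0 RintegralZl ?EW ?mulr0//.
  exact: sq_integrable_integrable.
rewrite AS.
under eq_Rintegral do rewrite mulrDl -!mulrA.
rewrite Rintegral_linear_comb.
- rewrite (IH _ (ltnW tu)) EWW; last by rewrite (ltn_eqF tu).
  by rewrite !mulr0 addr0.
- exact: sq_integrable_mul (sq_integrable_recursion t) (sW u).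
- exact: sq_integrable_mul.
Qed.

(** Without the cross term, the second moment obeys an affine recursion of ratio (1 - eta)^2, whose
    fixed point is eta^2 s2 / (1 - (1 - eta)^2) = eta s2 / (2 - eta). *)
Lemma recursion_second_moment t :
  Rintegral P setT (fun w => A t w ^+ 2) =
  (1 - eta) ^+ (2 * t) * c ^+ 2 +
  eta / (2 - eta) * (1 - (1 - eta) ^+ (2 * t)) * s2.
Proof.
have [e0 e1] := andP eta01.
have e2 : 2 - eta != 0 by rewrite gt_eqF//; lra.
elim: t => [|t IH].
  rewrite A0 muln0 expr0 subrr mulr0 mul0r addr0 mul1r.
  apply: etrans (Rintegral_cst P measurableT (c ^+ 2)) _.
  rewrite -[RHS]mulr1; congr (_ * _).
  exact: (congr1 fine (probability_setT P)).
have sA := sq_integrable_recursion t.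
have iA2 : P.-integrable setT (EFin \o (fun w => A t w ^+ 2)) by case: sA.
have iW2 : P.-integrable setT (EFin \o (fun w => W t w ^+ 2)) by case: (sW t).
have iAW := sq_integrable_mul sA (sW t).
transitivity (Rintegral P setT (fun w => 1 * ((1 - eta) ^+ 2 * A t w ^+ 2 +
    (- 2 * (1 - eta) * eta) * (A t w * W t w)) + eta ^+ 2 * W t w ^+ 2)).
  by rewrite AS; apply: eq_Rintegral => w _; ring.
rewrite Rintegral_linear_comb//; last exact: integrable_linear_comb.
rewrite Rintegral_linear_comb// recursion_uncorrelated// EW2 IH mulnS exprD.
by field.
Qed.

End recursion.

(** * Moments of the online SGD iterates *)

Section sgd_moments.
Context (R : realType) d (T : measurableType d) (P : probability T R).
Variables (X Y : nat -> T -> R) (mu1 mu2 a b eta theta0 : R).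
Hypotheses (a0 : 0 < a) (b0 : 0 < b) (eta01 : 0 < eta < 1)
  (HXY : forall t, has_mixture_law P (X t) (Y t) mu1 mu2 a b)
  (indep : mutually_independent P (fun t w => (X t w, Y t w))).

Let W t w : R := theta_star mu1 mu2 + X t w - Y t w.
Let s2 := a ^+ 2 * Gamma (3 / b) / Gamma b^-1 + (1 - (mu2 - mu1) / 2) ^+ 2.

Let mX t : measurable_fun setT (X t). Proof. by case: (HXY t). Qed.
Let mY t : measurable_fun setT (Y t). Proof. by case: (HXY t). Qed.

Let mW t : measurable_fun setT (W t).
Proof. by apply: measurable_funB => //; exact: measurable_funD. Qed.

Let EWs t s : (\int[P]_w ((W t w + s) ^+ 2)%:E = (s2 + s ^+ 2)%:E)%E.
Proof. exact: mixture_sqr. Qed.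

Let EW2e t : (\int[P]_w (W t w ^+ 2)%:E = s2%:E)%E.
Proof.
have := EWs t 0; rewrite expr0n/= addr0 => <-.
by apply: eq_integral => w _; rewrite addr0.
Qed.

Let sW t : sq_integrable P (W t).
Proof.
split; first exact: mW.
apply/integrableP; split.
  by apply/measurable_EFinP; exact: measurable_funX.
under eq_integral do rewrite gee0_abs ?lee_fin ?sqr_ge0//.
by rewrite EW2e ltry.
Qed.

Let EW2 t : Rintegral P setT (fun w => W t w ^+ 2) = s2.
Proof. by rewrite /Rintegral EW2e. Qed.

(* The mean is read off from the second moments of [W] and [W + 1]. *)
Let EW t : Rintegral P setT (W t) = 0.
Proof.
have iW := sq_integrable_integrable (sW t).
have iW2 : P.-integrable setT (EFin \o (fun w => W t w ^+ 2)) by case: (sW t).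
have i1 := sq_integrable_integrable (sq_integrable_cst P 1).
have E1 : Rintegral P setT (cst 1) = 1.
  rewrite -[RHS]mulr1; apply: etrans (Rintegral_cst P measurableT 1) _.
  by congr (_ * _); exact: (congr1 fine (probability_setT P)).
have : Rintegral P setT (fun w => (W t w + 1) ^+ 2) = s2 + 1.
  by rewrite /Rintegral EWs expr1n.
have -> : Rintegral P setT (fun w => (W t w + 1) ^+ 2) =
    Rintegral P setT (fun w => 1 * (1 * W t w ^+ 2 + 2 * W t w) + 1 * cst 1 w).
  by apply: eq_Rintegral => w _ /=; ring.
rewrite Rintegral_linear_comb//; last exact: integrable_linear_comb.
rewrite Rintegral_linear_comb// E1 EW2; set u := Rintegral _ _ _.
move: s2 u => s u; lra.
Qed.

Let EWW t u : t != u -> Rintegral P setT (fun w => W t w * W u w) = 0.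
Proof.
move=> tu; apply: independent_centered_mul => //.
- exact: sq_integrable_integrable.
- exact: sq_integrable_mul.
pose phi (z : R * R) := theta_star mu1 mu2 + z.1 - z.2.
have mphi : measurable_fun setT phi.
  by apply: measurable_funB => //; exact: measurable_funD.
exact: (mutually_independent_pair mphi indep tu).
Qed.

Let A t w : R := sgd eta theta0 X Y t w - theta_star mu1 mu2.

Let A0 : A 0 = cst (theta0 - theta_star mu1 mu2). Proof. by []. Qed.

Let AS t : A t.+1 = fun w => (1 - eta) * A t w + (- eta) * W t w.
Proof. by apply/funext => w; rewrite /A /W/=; ring. Qed.

Lemma sq_integrable_sgd t :
  sq_integrable P (fun w => sgd eta theta0 X Y t w - theta_star mu1 mu2).
Proof. exact: (sq_integrable_recursion sW A0 AS). Qed.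

Lemma sgd_second_moment t :
  Rintegral P setT (fun w => (sgd eta theta0 X Y t w - theta_star mu1 mu2) ^+ 2) =
  sgd_bound 1 mu1 mu2 a b eta theta0 t.
Proof.
by rewrite /sgd_bound mul1r; exact: (recursion_second_moment eta01 sW EW EW2 EWW A0 AS).
Qed.

End sgd_moments.

(** * From the second moment to the expected risk *)

Lemma sgd_bound_scale (R : realType) (C mu1 mu2 a b eta theta0 : R) t :
  sgd_bound C mu1 mu2 a b eta theta0 t = C * sgd_bound 1 mu1 mu2 a b eta theta0 t.
Proof. by rewrite /sgd_bound mul1r. Qed.

Unset Implicit Arguments.

Theorem theorem1 (R : realType) (mu1 mu2 a0 b0 : R) :
  mu1 < mu2 -> 0 < a0 -> 0 < b0 ->
  (forall theta : R,
     misclass mu1 mu2 a0 b0 (theta_star mu1 mu2) <= misclass mu1 mu2 a0 b0 theta) /\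
  exists C1 : R, 0 < C1 /\
    (forall theta : R,
       misclass mu1 mu2 a0 b0 theta - misclass mu1 mu2 a0 b0 (theta_star mu1 mu2)
         <= C1 * (theta - theta_star mu1 mu2) ^+ 2) /\
    (forall (a b theta0 eta : R), 0 < a -> 0 < b -> 0 < eta < 1 ->
       forall (d : measure_display) (T : measurableType d) (P : probability T R)
              (X Y : nat -> T -> R),
       (forall t, has_mixture_law P (X t) (Y t) mu1 mu2 a b) ->
       mutually_independent P (fun t w => (X t w, Y t w)) ->
       forall t : nat,
         ('E_P[fun w => misclass mu1 mu2 a0 b0 (sgd eta theta0 X Y t w)]
            - (misclass mu1 mu2 a0 b0 (theta_star mu1 mu2))%:E
          <= (sgd_bound C1 mu1 mu2 a b eta theta0 t)%:E)%E) /\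
    (forall (a a' b theta0 eta : R) (t : nat), 0 < a -> a <= a' -> 0 < b ->
       0 < eta < 1 ->
       sgd_bound C1 mu1 mu2 a b eta theta0 t <= sgd_bound C1 mu1 mu2 a' b eta theta0 t).
Proof.
move=> mu12 a00 b00; split; first exact: theta_star_optimal.
have [C C0 quad] := misclass_quadratic mu12 a00 b00.
exists C; split => //; split => //; split; last first.
  (* The scale enters only through its square, whose coefficient is nonnegative because (1 - eta)^(2
     t) <= 1 and the Gamma values are nonnegative. *)
  move=> a a' b theta0 eta t ha aa' hb /andP[e0 e1].
  rewrite ler_wpM2l ?(ltW C0)// lerD2l ler_wpM2l//.
    rewrite mulr_ge0 ?divr_ge0 ?subr_ge0 ?(ltW e0)//; first by lra.
    by rewrite exprn_ile1; lra.
  rewrite lerD2r ler_wpM2r ?invr_ge0 ?Gamma_ge0// ler_wpM2r ?Gamma_ge0//.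
  by rewrite lerXn2r ?nnegrE ?(ltW ha)// (le_trans _ aa')// ltW.
move=> a b theta0 eta ha hb eta01 d T P X Y HXY indep t.
set L := misclass mu1 mu2 a0 b0 (theta_star mu1 mu2).
pose A w := sgd eta theta0 X Y t w - theta_star mu1 mu2.
have [mA iA2] : sq_integrable P A.
  exact: (sq_integrable_sgd eta theta0 ha hb HXY).
have msgd : measurable_fun setT (sgd eta theta0 X Y t).
  rewrite (_ : sgd _ _ _ _ _ = fun w => A w + theta_star mu1 mu2).
    exact: measurable_funD.
  by apply/funext => w; rewrite /A subrK.
have iA2' : P.-integrable setT (EFin \o (fun w => A w ^+ 2)) by [].
have i1 := sq_integrable_integrable (sq_integrable_cst P 1).
have iB := integrable_linear_comb C L iA2' i1.
(* The quadratic majorant of the risk has an exactly known expectation. *)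
have EB : (\int[P]_w (C * A w ^+ 2 + L * cst 1 w)%:E =
    (sgd_bound C mu1 mu2 a b eta theta0 t + L)%:E)%E.
  rewrite -[LHS]fineK; last exact: (integrable_fin_num _ iB).
  congr EFin; rewrite -/(Rintegral P setT (fun w => C * A w ^+ 2 + L * cst 1 w)).
  rewrite (Rintegral_linear_comb C L iA2' i1) sgd_bound_scale.
  rewrite (sgd_second_moment theta0 ha hb eta01 HXY indep); congr (_ + _).
  rewrite -[RHS]mulr1; congr (_ * _).
  rewrite -[RHS]mulr1; apply: etrans (Rintegral_cst P measurableT 1) _.
  by congr (_ * _); exact: (congr1 fine (probability_setT P)).
(* With the optimal risk [L] moved to the right, the claim compares two integrals pointwise;
   nonnegativity and measurability of the risk suffice. *)
rewrite leeBlDr// -EFinD -EB unlock.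
apply: ge0_le_integral => //.
- by move=> w _; rewrite lee_fin misclass_ge0.
- apply/measurable_EFinP; apply: measurableT_comp msgd.
  exact: measurable_misclass.
- exact: measurable_int iB.
- by move=> w _; rewrite lee_fin mulr1 -lerBlDr quad.
Qed.
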